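(* Let $n\ge 4$ be an integer and let $K_n$ be the complete graph on vertex set $\{1,\dots,n\}$. Then, with $o(1)$ denoting a quantity tending to $0$ as $n\to\infty$: \begin{itemize} \item if $n$ is even, then $\frac{1}{12}n^2-\frac{1}{6}n \le \gamma(F_3(K_n)) \le (1+o(1))\left(\frac{1}{12}n^2-\frac{1}{6}n\right)$; \item if $n$ is odd, then $\frac{1}{12}n^2-\frac{1}{6}n+\frac14 \le \gamma(F_3(K_n)) \le (1+o(1))\left(\frac{1}{12}n^2-\frac{1}{6}n+\frac14\right)$; \item if $n\equiv 2$ or $6 \pmod{12}$, then $\gamma(F_3(K_n)) = \frac{1}{12}n^2-\frac{1}{6}n$. \end{itemize}
   Context: For a simple graph $G$ and an integer $k$ with $1 \le k \le |V(G)|-1$, the $k$-token graph $F_k(G)$ is the graph whose vertices are the $k$-element subsets of $V(G)$, two of them being adjacent if and only if their symmetric difference is a pair $\{u,v\}$ with $uv$ an edge of $G$. (Thus $F_3(K_n)$ is the Johnson graph $J(n,3)$: $3$-subsets of $\{1,\dots,n\}$, adjacent when they share exactly $2$ elements.) A dominating set of a graph $H$ is a set $D\subseteq V(H)$ such that every vertex of $H$ is in $D$ or has a neighbor in $D$; the domination number $\gamma(H)$ is the minimum size of a dominating set. *)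

(* Defs.v *)
From mathcomp Require Import all_boot.

Set Implicit Arguments.
Unset Strict Implicit.
Unset Printing Implicit Defensive.

Record sgraph := SGraph {
  vertex : finType;
  edge : rel vertex;
  edge_sym : symmetric edge;
  edge_irr : irreflexive edge }.

Definition dominating (G : sgraph) (D : {set vertex G}) : bool :=
  [forall v, (v \in D) || [exists u in D, edge u v]].

(* The default [set: vertex G] of the arg min is itself dominating, so this is
   a genuine minimum. *)
Definition domination_number (G : sgraph) : nat :=
  #|[arg min_(D < [set: vertex G] | dominating D) #|D|]|.

Lemma complete_edge_sym (T : finType) : symmetric (fun u v : T => u != v).
Proof. by move=> u v; rewrite eq_sym. Qed.

Lemma complete_edge_irr (T : finType) : irreflexive (fun u v : T => u != v).
Proof. by move=> u; rewrite eqxx. Qed.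

Definition complete_graph (n : nat) : sgraph :=
  SGraph (@complete_edge_sym 'I_n) (@complete_edge_irr 'I_n).

Section TokenGraph.
Variables (k : nat) (G : sgraph).

Definition token_vertex : finType := {A : {set vertex G} | #|A| == k}.

Definition token_edge : rel token_vertex := fun A B =>
  [exists u, exists v, edge u v &&
    ((val A :\: val B) :|: (val B :\: val A) == [set u; v])].

Lemma token_edge_sym : symmetric token_edge.
Proof.
by move=> A B; rewrite /token_edge; under eq_existsb => u do
  under eq_existsb => v do rewrite setUC.
Qed.

Lemma token_edge_irr : irreflexive token_edge.
Proof.
move=> A; apply/existsP => -[u /existsP[v /andP[_]]].
rewrite setDv setU0 => /eqP /setP /(_ u).
by rewrite !inE eqxx.
Qed.

(* Meant for 1 <= k <= #|vertex G|.-1, but total in k. *)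
Definition token_graph : sgraph := SGraph token_edge_sym token_edge_irr.

End TokenGraph.

(* Main.v *)
(* A set of triples dominates F_3(K_n) iff the graph of the pairs that it leaves
   uncovered is triangle-free. By Mantel's theorem at least n(n-2)/4 pairs are
   then covered, three per triple at most, which is the lower bound; for odd n
   parity excludes the extremal configuration. Conversely, split the n points
   into two halves and cover all pairs inside each half by triples: any three
   points have two in the same half. Steiner triple systems exist for all orders
   congruent to 1 or 3 mod 6, so this is optimal for n congruent to 2 or 6 mod 12;
   any other n is obtained by restriction from such an n' <= n + 8. *)
Require Import Defs.
From HB Require Import structures.
From mathcomp Require Import all_boot all_order all_algebra zify.

Set Implicit Arguments.
Unset Strict Implicit.
Unset Printing Implicit Defensive.

(** * Closed neighbourhoods in the Johnson graph *)

Local Notation johnson3 n := (token_graph 3 (complete_graph n)) (only parsing).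

(** Both differences have 3 minus [#|val A :&: val B|] elements, so adjacency means exactly two
    common points and equality means three. *)
Lemma token3_edgeE n (A B : vertex (johnson3 n)) :
  (A == B) || edge A B = (2 <= #|val A :&: val B|).
Proof.
have cA : #|val A| = 3 by apply/eqP; exact: (valP A).
have cB : #|val B| = 3 by apply/eqP; exact: (valP B).
have IA := cardsID (val B) (val A); have IB := cardsID (val A) (val B).
rewrite setIC in IB.
apply/idP/idP => [/orP[/eqP <-|/existsP[u /existsP[v /andP[uv /eqP E]]]]|le2].
- by rewrite setIid cA.
- have : #|(val A :\: val B) :|: (val B :\: val A)| = 2 by rewrite E cards2 (uv : u != v).
  rewrite cardsU (_ : _ :&: _ = set0) ?cards0; last first.
    by apply/setP => x; rewrite !inE; case: (x \in val A); case: (x \in val B).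
  lia.
- have [//|nAB /=] := eqVneq A B.
  have sub X Y : #|X : {set 'I_n}| = 3 -> #|Y : {set 'I_n}| = 3 ->
      2 < #|X :&: Y| -> X = Y.
    move=> cX cY l3; have /eqP XY : X :&: Y == X.
      by rewrite eqEcard subsetIl cX.
    have /eqP YX : X :&: Y == Y by rewrite eqEcard subsetIr cY.
    by rewrite -XY YX.
  have nl : ~~ (2 < #|val A :&: val B|).
    by apply: contra nAB => /sub e; apply/eqP/val_inj; rewrite e.
  have /eqP/cards1P[u Eu] : #|val A :\: val B| = 1 by lia.
  have /eqP/cards1P[v Ev] : #|val B :\: val A| = 1 by lia.
  apply/existsP; exists u; apply/existsP; exists v; rewrite Eu Ev eqxx andbT.
  have : u \in val A :\: val B by rewrite Eu set11.
  have : v \in val B :\: val A by rewrite Ev set11.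
  rewrite !inE => /andP[nv _] /andP[_ uA].
  by apply: contraNneq nv => <-.
Qed.

Lemma dominatingP n (D : {set vertex (johnson3 n)}) :
  reflect (forall A : {set 'I_n}, #|A| = 3 ->
             exists2 B, B \in D & 2 <= #|A :&: val B|)
          (dominating D).
Proof.
apply: (iffP forallP) => [dom A /eqP cA|dom A].
  have /orP[AD|/existsP[B /andP[BD BA]]] := dom (exist _ A cA : vertex (johnson3 n)).
    by exists (exist _ A cA) => //=; rewrite setIid (eqP cA).
  by exists B => //; rewrite setIC -[A]/(val (exist _ A cA : vertex (johnson3 n)))
    -token3_edgeE BA orbT.
have [B BD] := dom (val A) (eqP (valP A)).
rewrite setIC -token3_edgeE => /orP[/eqP <-|BA]; first by rewrite BD.
by apply/orP; right; apply/existsP; exists B; rewrite BD.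
Qed.

Lemma domination_number_attained (G : sgraph) :
  exists2 D : {set vertex G}, dominating D & domination_number G = #|D|.
Proof.
rewrite /domination_number; case: arg_minnP => [|D dom _]; last by exists D.
by apply/forallP => v; rewrite inE.
Qed.

Lemma domination_number_le (G : sgraph) (D : {set vertex G}) :
  dominating D -> domination_number G <= #|D|.
Proof.
move=> dom; rewrite /domination_number; case: arg_minnP => [|E _]; last exact.
by apply/forallP => v; rewrite inE.
Qed.

(** * Mantel's theorem, with a parity refinement *)

Section Mantel.
Variables (T : finType) (h : rel T).
Hypothesis triangle_free : forall x y z, h x y -> h x z -> ~~ h y z.

Let deg x := #|[set y | h x y]|.
Let n := #|T|.

(* If [v] has maximal degree [d], its neighbourhood is independent, so the
   vertices inside it have degree at most [n - d]; those outside have degree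
   at most [d]. *)
Lemma sum_deg_leqif_max :
  0 < n -> exists v, \sum_x deg x <= 2 * (deg v * (n - deg v))
     ?= iff [forall x, deg x == if h v x then n - deg v else deg v].
Proof.
move=> /card_gt0P[x0 _].
case: (@arg_maxnP T x0 predT deg) => // v _ maxv; exists v.
have E : 2 * (deg v * (n - deg v))
    = \sum_x if h v x then n - deg v else deg v.
  rewrite (bigID (h v)) /= mul2n -addnn; congr (_ + _).
    rewrite (eq_bigr (fun=> n - deg v)) => [|x ->//].
    by rewrite sum_nat_const /deg cardsE.
  rewrite (eq_bigr (fun=> deg v)) => [|x /negbTE ->//].
  rewrite sum_nat_const mulnC; congr (_ * _).
  by rewrite /n -(cardC (h v)) /deg cardsE addKn; apply: eq_card.
rewrite E; apply: leqif_sum => x _; split=> //.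
have [vx|_] := boolP (h v x); last exact: maxv.
rewrite leq_subRL ?max_card // addnC -cardsUI (_ : _ :&: _ = set0).
  by rewrite cards0 addn0 max_card.
apply/setP => y; rewrite !inE; apply/negP => /andP[xy vy].
by move: xy; apply/negP/triangle_free; [exact: vx|exact: vy].
Qed.

Lemma mantel : 2 * \sum_x deg x <= n ^ 2.
Proof.
have [n0|/sum_deg_leqif_max[v [le _]]] := posnP n.
  by rewrite big1 // => x; have := card0_eq n0 x; rewrite inE.
apply: leq_trans (_ : 4 * (deg v * (n - deg v)) <= _); first by lia.
have dn : deg v <= n by rewrite max_card.
by rewrite -[in n ^ 2](subnKC dn) nat_AGM2.
Qed.

(** Equality in [sum_deg_leqif_max] would give each neighbour of [v] the degree [n - deg v], which
    is odd. So the sum is strictly smaller when [v] has a neighbour, and it vanishes otherwise. *)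
Lemma mantel_even_degrees :
  1 < n -> odd n -> (forall x, ~~ odd (deg x)) -> 2 * \sum_x deg x + 1 < n ^ 2.
Proof.
move=> n1 on ed.
have [v mv] := sum_deg_leqif_max (ltnW n1).
have dn : deg v <= n by rewrite max_card.
have od : odd (n - deg v) by rewrite oddB // on (negbTE (ed v)).
have [d0|d_gt0] := posnP (deg v).
  by move: mv => [+ _]; rewrite d0 mul0n muln0; lia.
have lt : \sum_x deg x < 2 * (deg v * (n - deg v)).
  rewrite (ltn_leqif mv); apply/negP => /forallP Ex.
  have /card_gt0P[x] := d_gt0; rewrite inE => vx.
  by have := Ex x; rewrite vx => /eqP Ed'; have := ed x; rewrite Ed' od.
apply: leq_trans (_ : 4 * (deg v * (n - deg v)) <= _); first by lia.
by rewrite -[in n ^ 2](subnKC dn) nat_AGM2.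
Qed.

End Mantel.

(** * The lower bound by counting pairs *)

Section LowerBound.
Variables (n : nat) (D : {set vertex (johnson3 n)}).
Hypothesis dom : dominating D.

Let uncovered : rel 'I_n := fun x y =>
  (x != y) && [forall B in D, ~~ ((x \in val B) && (y \in val B))].
Let deg x := #|[set y | uncovered x y]|.
Let repl x := #|[set B in D | x \in val B]|.

(** The vertices of a triangle would form a triple, and the block dominating it covers one of its
    pairs. *)
Lemma uncovered_triangle_free x y z :
  uncovered x y -> uncovered x z -> ~~ uncovered y z.
Proof.
move=> /andP[xy /forall_inP Uxy] /andP[xz /forall_inP Uxz].
apply/negP => /andP[yz /forall_inP Uyz].
have c3 : #|[set x; y; z]| = 3.
  by rewrite -setUA cardsU1 !inE negb_or xy xz cards2 yz.
have [B BD] := dominatingP _ dom _ c3.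
move=> /card_gt1P[a [b [+ + ab]]].
rewrite !inE => /andP[ha aB] /andP[hb bB].
have := Uxy B BD; have := Uxz B BD; have := Uyz B BD.
by case/orP: ha => [/orP[]|] /eqP ea; case/orP: hb => [/orP[]|] /eqP eb;
  move: ab aB bB; rewrite ea eb ?eqxx // => _ -> ->.
Qed.

(** Each other point forms an uncovered pair with [x] or lies in one of the [repl x] blocks through
    [x], which have two further points each. *)
Lemma deg_repl x : n.-1 <= deg x + 2 * repl x.
Proof.
have -> : n.-1 = #|[set~ x]| by rewrite cardsC1 card_ord.
have sub : [set~ x] \subset
    [set y | uncovered x y] :|: \bigcup_(B in [set B in D | x \in val B]) (val B :\ x).
  apply/subsetP => y; rewrite !inE => yx.
  have [//|] := boolP (uncovered x y).
  rewrite negb_and negbK eq_sym (negbTE yx) => /forall_inPn[B BD /negPn/andP[xB yB]].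
  by apply/orP; right; apply/bigcupP; exists B; rewrite !inE ?BD ?yx.
apply: leq_trans (subset_leq_card sub) _.
apply: leq_trans (leq_card_setU _ _) _; rewrite leq_add2l.
rewrite mulnC -sum_nat_const.
elim/big_ind2: _ => [|X b Y c leX leY|B]; first by rewrite cards0.
  by apply: leq_trans (leq_card_setU _ _) _; exact: leq_add.
rewrite inE => /andP[_ xB].
by have := cardsD1 x (val B); rewrite xB (eqP (valP B)) add1n => - [<-].
Qed.

Lemma sum_repl : \sum_x repl x = 3 * #|D|.
Proof.
under eq_bigr => x _ do rewrite /repl -sum1dep_card big_mkcondr.
rewrite exchange_big /= mulnC -sum_nat_const; apply: eq_bigr => B _.
by rewrite -big_mkcond /= sum1_card (eqP (valP B)).
Qed.

Lemma sum_deg_repl : \sum_x (deg x + 2 * repl x) = \sum_x deg x + 6 * #|D|.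
Proof. by rewrite big_split -big_distrr /= sum_repl mulnA. Qed.

Lemma dominating_lower : n * n.-2 <= 12 * #|D|.
Proof.
have := mantel uncovered_triangle_free; rewrite card_ord -/deg.
have : \sum_(x < n) n.-1 <= \sum_x (deg x + 2 * repl x).
  by apply: leq_sum => x _; exact: deg_repl.
rewrite sum_deg_repl sum_nat_const card_ord.
move: (\sum_x deg x) #|D| => S d; case: n => [|[|k]] //=; nia.
Qed.

(* Either some vertex makes [deg_repl] strict, which gains enough, or every
   vertex lies in an even number of uncovered pairs. *)
Lemma dominating_lower_odd : 1 < n -> odd n -> n * n.-2 + 3 <= 12 * #|D|.
Proof.
move=> n1 on.
have lei : \sum_(x < n) n.-1 <= \sum_x (deg x + 2 * repl x)
    ?= iff [forall x, n.-1 == deg x + 2 * repl x].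
  by apply: leqif_sum => x _; split=> //; exact: deg_repl.
(* Both cases below gain 2. This form of [n] lets [nia] round the gain up to 3, since [n ^ 2] is odd
   and twice the degree sum is even. *)
have [k En] : exists k, n = 2 * k + 1.
  by exists n./2; rewrite -[LHS]odd_double_half on addnC mul2n.
have [/forallP eqd|neqd] := boolP [forall x, n.-1 == deg x + 2 * repl x].
  have ed x : ~~ odd (deg x) by have /eqP := eqd x; lia.
  have := mantel_even_degrees uncovered_triangle_free.
  rewrite card_ord -/deg => /(_ n1 on ed).
  have : \sum_(x < n) n.-1 = \sum_x (deg x + 2 * repl x).
    by apply: eq_bigr => x _; apply/eqP.
  rewrite sum_deg_repl sum_nat_const card_ord.
  move: (\sum_x deg x) #|D| => S d.
  have -> : n.-2 = 2 * k - 1 by lia.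
  have -> : n.-1 = 2 * k by lia.
  rewrite En; nia.
have := mantel uncovered_triangle_free; rewrite card_ord -/deg.
have : \sum_(x < n) n.-1 < \sum_x (deg x + 2 * repl x).
  by rewrite (ltn_leqif lei).
rewrite sum_deg_repl sum_nat_const card_ord.
move: (\sum_x deg x) #|D| => S d.
have -> : n.-2 = 2 * k - 1 by lia.
have -> : n.-1 = 2 * k by lia.
rewrite En; nia.
Qed.

End LowerBound.

(** * Steiner triple systems of orders 1 and 3 modulo 6 *)

(** A Steiner triple system relaxed to a covering: small blocks and repeated pairs are allowed, and
    the bound on [#|s|] in [bose] and [skolem] restores optimality. *)
Definition triple_cover (P : finType) (s : {set {set P}}) :=
  (forall B, B \in s -> #|B| <= 3) /\
  forall x y, x != y -> exists B, [/\ B \in s, x \in B & y \in B].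

Section CyclicBlocks.
Variables (k : nat) (P : finType) (pt : 'I_3 -> 'I_k -> P).
Variable op : 'I_k -> 'I_k -> 'I_k.

Definition column_block (x : 'I_k) : {set P} :=
  [set pt i x | i : 'I_3].

(** [op] stands for the commutative quasigroup of the classical constructions, idempotent for Bose
    and half-idempotent for Skolem. The three levels [pt i] are in cyclic order. *)
Definition mixed_block (q : 'I_k * 'I_k * 'I_3) : {set P} :=
  [set pt q.2 q.1.1; pt q.2 q.1.2; pt (ordS q.2) (op q.1.1 q.1.2)].

Definition mixed_blocks : {set {set P}} :=
  [set mixed_block q | q : 'I_k * 'I_k * 'I_3 in
    [set q : 'I_k * 'I_k * 'I_3 | q.1.1 < q.1.2]].

Lemma card_column_block x : #|column_block x| <= 3.
Proof. by rewrite (leq_trans (leq_imset_card _ _)) // card_ord. Qed.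

Lemma card_set3 (a b c : P) : #|[set a; b; c]| <= 3.
Proof. by rewrite -setUA cardsU1 cards2; case: (_ \in _) (_ != _) => [] []. Qed.

Lemma card_lt_pairs : #|[set p : 'I_k * 'I_k | p.1 < p.2]| = 'C(k, 2).
Proof.
rewrite -triangular_sum big_mkord -sum1dep_card.
rewrite -(pair_big_dep predT (fun x y : 'I_k => x < y) (fun _ _ => 1)) /=.
rewrite (exchange_big_dep predT) //=; apply: eq_bigr => y _.
by rewrite -[RHS]card_ord -sum1_card (big_ord_widen k (fun=> 1)) // ltnW.
Qed.

Lemma card_mixed_blocks : #|mixed_blocks| <= 3 * 'C(k, 2).
Proof.
apply: leq_trans (leq_imset_card _ _) _.
rewrite (_ : [set q | _] = setX [set p : 'I_k * 'I_k | p.1 < p.2] [set: 'I_3]).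
  by rewrite cardsX card_lt_pairs cardsT card_ord mulnC.
by apply/setP => -[p i]; rewrite !inE andbT.
Qed.

Hypothesis opC : commutative op.
Hypothesis op_solve : forall x z, exists y, op x y = z.

Definition joined (s : {set {set P}}) x y := exists B, [/\ B \in s, x \in B & y \in B].

Lemma joined_sym s x y : joined s x y -> joined s y x.
Proof. by case=> B []; exists B. Qed.

Variable s : {set {set P}}.
Hypothesis mixed_s : mixed_blocks \subset s.

Lemma mixed_joined i x y : x != y ->
  joined s (pt i x) (pt i y) /\ joined s (pt i x) (pt (ordS i) (op x y)).
Proof.
wlog lt : x y / x < y => [IH xy|_].
  have [lt|lt|/val_inj e] := ltngtP x y; [exact: IH| |by rewrite e eqxx in xy].
  have [] := IH _ _ lt; first by rewrite eq_sym.
  have Bs : mixed_block (y, x, i) \in s.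
    by apply: (subsetP mixed_s); rewrite imset_f // inE.
  split; first exact: joined_sym.
  by exists (mixed_block (y, x, i)); split=> //; rewrite !inE 1?opC eqxx ?orbT.
have Bs : mixed_block (x, y, i) \in s.
  by apply: (subsetP mixed_s); rewrite imset_f // inE.
by split; exists (mixed_block (x, y, i)); rewrite !inE !eqxx ?orbT.
Qed.

Lemma column_joined i j x : column_block x \in s -> joined s (pt i x) (pt j x).
Proof. by move=> ?; exists (column_block x); rewrite !imset_f. Qed.

Lemma ord3_cases (i j : 'I_3) : [\/ i = j, j = ordS i | i = ordS j].
Proof.
case: i j => [] [|[|[|//]]] ? [] [|[|[|//]]] ?; do ?[
  by apply: Or31; apply: val_inj | by apply: Or32; apply: val_inj
  | by apply: Or33; apply: val_inj].
Qed.

(** Any two levels are equal or consecutive. To join [x] to [z] on the next level, solve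
    [op x y = z] and take the mixed block of [x] and [y]; the case [y = x], which has no mixed
    block, is left to [diag]. *)
Lemma mixed_cover :
  (forall i x, joined s (pt i x) (pt (ordS i) (op x x))) ->
  forall i j x y, (i, x) != (j, y) -> joined s (pt i x) (pt j y).
Proof.
move=> diag.
have up i x z : joined s (pt i x) (pt (ordS i) z).
  have [y <-] := op_solve x z; have [<-//|xy] := eqVneq x y.
  by case: (mixed_joined i xy).
move=> i j x y; case: (ord3_cases i j) => [->|->|->] ne.
- by case: (@mixed_joined j x y) => //; apply: contra ne => /eqP ->.
- exact: up.
- exact: joined_sym.
Qed.

End CyclicBlocks.

(* Bose's construction of Steiner triple systems on Z_3 x Z_(2t+1); [op x y] is
   (x + y) / 2. *)
Lemma bose t : exists (P : finType) (s : {set {set P}}),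
  [/\ #|P| = 6 * t + 3, triple_cover s & 6 * #|s| <= #|P| * #|P|.-1].
Proof.
pose k := (2 * t).+1; pose P : finType := ('I_3 * 'I_k)%type.
pose pt i x : P := (i, x).
(* [t.+1] is the inverse of 2 modulo [k]. *)
pose op (x y : 'I_k) : 'I_k := ((x + y) *+ t.+1)%R.
pose col := [set column_block pt x | x : 'I_k].
pose s := col :|: mixed_blocks pt op.
have ordk (x : 'I_k) : (x *+ k = 0)%R.
  apply: val_inj; rewrite /= Zp_mulrn /=.
  by rewrite modnMl.
have half (x : 'I_k) : ((x *+ 2) *+ t.+1 = x)%R.
  have e : 2 * t.+1 = k.+1 by rewrite /k; lia.
  by rewrite -GRing.mulrnA e GRing.mulrS ordk GRing.addr0.
have cP : #|P| = 6 * t + 3 by rewrite card_prod !card_ord; lia.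
exists P, s; split=> //.
  split=> [B|[i x] [j y]].
    case/setUP=> /imsetP[q _ ->]; first exact: card_column_block.
    exact: card_set3.
  apply: (@mixed_cover _ P pt op).
  - by move=> a b; rewrite /op GRing.addrC.
  - by move=> a c; exists (c *+ 2 - a)%R; rewrite /op GRing.addrC GRing.subrK half.
  - exact: subsetUr.
  - move=> {}i {}x; rewrite /op -GRing.mulr2n half.
    by apply: column_joined; rewrite inE imset_f.
(* One column block per element of ['I_k]; with [#|P| = 3 * k] the count is exact. *)
apply: leq_trans (_ : 6 * (k + 3 * 'C(k, 2)) <= _); last first.
  rewrite cP bin2 /k /= -divn2; nia.
rewrite leq_mul2l /=; apply: leq_trans (leq_card_setU _ _) _.
apply: leq_add; last exact: card_mixed_blocks.
by apply: leq_trans (leq_imset_card _ _) _; rewrite card_ord.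
Qed.

(* Skolem's construction on Z_3 x Z_(2t) and a point at infinity. Halving is no
   longer possible in Z_(2t), so [op] composes the sum with a bijection sending
   2x to x mod t; the idempotence missing for x >= t is made up for by the
   blocks through infinity. *)
Lemma skolem t : exists (P : finType) (s : {set {set P}}),
  [/\ #|P| = 6 * t + 1, triple_cover s & 6 * #|s| <= #|P| * #|P|.-1].
Proof.
pose k := 2 * t; pose P : finType := option ('I_3 * 'I_k).
pose pt i x : P := Some (i, x).
(* The bijection sends 2s to s and 2s + 1 to s + t. *)
have sig_lt (x y : 'I_k) : let r := (x + y) %% k in
    r./2 + odd r * t < k.
  move=> r; have : r < k by rewrite ltn_mod (leq_ltn_trans _ (ltn_ord x)).
  rewrite /k; case: (odd r) (odd_double_half r); lia.
pose op (x y : 'I_k) : 'I_k := Ordinal (sig_lt x y).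
have lo_lt (x : 'I_t) : x < k by case: x => /=; rewrite /k; lia.
have hi_lt (x : 'I_t) : x + t < k by case: x => /=; rewrite /k; lia.
pose lo x := Ordinal (lo_lt x); pose hi x := Ordinal (hi_lt x).
have op_lo x : op (lo x) (lo x) = lo x.
  apply: val_inj => /=; case: x => x /= xt.
  rewrite modn_small; last by rewrite /k; lia.
  by rewrite addnn odd_double doubleK mul0n addn0.
have op_hi x : op (hi x) (hi x) = lo x.
  apply: val_inj => /=; case: x => x /= xt.
  rewrite (_ : x + t + (x + t) = k + x.*2); last by rewrite /k; lia.
  rewrite modnDl modn_small; last by rewrite /k; lia.
  by rewrite odd_double doubleK mul0n addn0.
have split_k (x : 'I_k) : (exists y, x = lo y) \/ (exists y, x = hi y).
  have [xt|tx] := ltnP x t; [left|right].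
    by exists (Ordinal xt); apply: val_inj.
  have xt : x - t < t by case: x tx => /= x; rewrite /k; lia.
  by exists (Ordinal xt); apply: val_inj; rewrite /= subnK.
(* These blocks join infinity to every point, and also [hi x] to its square [lo x] one level up. *)
pose inf_block (q : 'I_3 * 'I_t) : {set P} :=
  [set None; pt q.1 (hi q.2); pt (ordS q.1) (lo q.2)].
pose col := [set column_block pt (lo x) | x : 'I_t].
pose inf := [set inf_block q | q : 'I_3 * 'I_t].
pose s := col :|: inf :|: mixed_blocks pt op.
have infs q : inf_block q \in s by rewrite 2!inE (imset_f inf_block) ?orbT.
have inf_joined i x : joined s None (pt i x).
  have [[y ->]|[y ->]] := split_k x.
    exists (inf_block (ord_pred i, y)).
    by split; [exact: infs| |]; rewrite !inE //= ord_predK eqxx !orbT.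
  by exists (inf_block (i, y)); split; [exact: infs| |];
    rewrite !inE ?eqxx ?orbT.
have cP : #|P| = 6 * t + 1 by rewrite card_option card_prod !card_ord /k; lia.
exists P, s; split=> //.
  split=> [B|].
    rewrite 2!inE => /orP[/orP[]|] /imsetP[q _ ->]; last exact: card_set3.
      exact: card_column_block.
    exact: card_set3.
  move=> [[i x]|] [[j y]|] ne; last by rewrite eqxx in ne.
  2: exact/joined_sym/inf_joined.
  2: exact: inf_joined.
  apply: (@mixed_cover _ P pt op) ne.
  - by move=> a b; apply: val_inj; rewrite /= [in LHS](addnC a b).
  - move=> a c.
    have k0 : 0 < k := leq_ltn_trans (leq0n a) (ltn_ord a).
    (* [r] is the preimage of [c] under the bijection, so the solution is [r - a] modulo [k]. *)
    pose r := if c < t then c.*2 else (c - t).*2.+1.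
    have rk : r < k.
      by rewrite /r; move: (val c) (ltn_ord c) => d; rewrite /k; case: (ltnP d t); lia.
    exists (Ordinal (ltn_pmod (r + (k - a)) k0)); apply: val_inj => /=.
    rewrite modnDmr addnCA subnKC; last by rewrite ltnW.
    rewrite modnDr modn_small // /r.
    case: ltnP => ct; first by rewrite odd_double doubleK mul0n addn0.
    by rewrite /= odd_double uphalf_double mul1n subnK.
  - exact: subsetUr.
  - move=> {}i {}x; have [[z ->]|[z ->]] := split_k x.
      rewrite op_lo; apply: column_joined; rewrite 2!inE.
      by apply/orP; left; apply/orP; left; apply/imsetP; exists z.
    rewrite op_hi; exists (inf_block (i, z)).
    by split; [exact: infs| |]; rewrite !inE eqxx ?orbT.
(* Columns over the lower half only, then the blocks through infinity, then the mixed ones. *)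
apply: leq_trans (_ : 6 * (t + 3 * t + 3 * 'C(k, 2)) <= _); last first.
  rewrite cP bin2 /k -divn2; nia.
rewrite leq_mul2l /=; apply: leq_trans (leq_card_setU _ _) _.
apply: leq_add; last exact: card_mixed_blocks.
apply: leq_trans (leq_card_setU _ _) _.
apply: leq_add; apply: leq_trans (leq_imset_card _ _) _; rewrite ?card_ord //.
by rewrite card_prod !card_ord.
Qed.

(** * Upper bounds from two copies of a triple cover *)

Lemma exists_token3_sup n (C : {set 'I_n}) : 2 < n -> #|C| <= 3 ->
  exists A : vertex (johnson3 n), C \subset val A.
Proof.
move=> n2; have [m] := ubnP (3 - #|C|).
elim: m C => // m IH C mC C3.
have [/eqP c3|nc3] := boolP (#|C| == 3).
  have cC : #|C| == 3 by rewrite c3.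
  by exists (exist _ C cC).
have /card_gt0P[x] : 0 < #|~: C|.
  by have := cardsC C; rewrite card_ord; lia.
rewrite inE => xC; have cx : #|x |: C| = #|C|.+1 by rewrite cardsU1 xC.
have [|//|A sub] := IH (x |: C); rewrite ?cx; try lia.
by exists A; apply: subset_trans sub; exact: subsetUr.
Qed.

(** Two of any three points fall in the same copy of [P], where some block contains both. Blocks are
    pulled back along an injection, which allows smaller [n], and then padded to triples. *)
Lemma johnson3_le_cover n (P : finType) (s : {set {set P}}) :
  2 < n <= 2 * #|P| -> triple_cover s ->
  domination_number (johnson3 n) <= 2 * #|s|.
Proof.
case/andP=> n2 nP [s3 cov].
have cBP : #|{: bool * P}| = 2 * #|P| by rewrite card_prod card_bool.
pose h (i : 'I_n) : bool * P :=
  enum_val (cast_ord (esym cBP) (widen_ord nP i)).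
have h_inj : injective h.
  by move=> i j /enum_val_inj /cast_ord_inj /(congr1 val) /= /val_inj.
pose pull (q : bool * {set P}) := [set i | (h i).1 == q.1 & (h i).2 \in q.2].
have pull3 q : q.2 \in s -> #|pull q| <= 3.
  move=> /s3; apply: leq_trans; rewrite -(card_in_imset (f := fun i => (h i).2)).
    by apply: subset_leq_card; apply/subsetP => _ /imsetP[i + ->]; rewrite inE => /andP[].
  move=> i j; rewrite !inE => /andP[/eqP i1 _] /andP[/eqP j1 _] e2.
  by apply: h_inj; rewrite [h i]surjective_pairing [h j]surjective_pairing i1 j1 e2.
have [|A0 _] := exists_token3_sup (C := set0) n2; first by rewrite cards0.
(* [A0] is a mere default: [pick] succeeds on sets of at most three points. *)
pose ext (C : {set 'I_n}) := odflt A0 [pick A : vertex (johnson3 n) | C \subset val A].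
have extP (C : {set 'I_n}) : #|C| <= 3 -> C \subset val (ext C).
  move=> C3; rewrite /ext; case: pickP => [//|none].
  by have [A] := exists_token3_sup n2 C3; rewrite none.
pose D := [set ext (pull q) | q in setX [set: bool] s].
have : dominating D.
  apply/dominatingP => A A3.
  have [i [j [iA jA ij hij]]] : exists i j, [/\ i \in A, j \in A, i != j & (h i).1 = (h j).1].
    have /card_gt2P[x [y [z [[xA yA zA] [xy yz zx]]]]] : 2 < #|A| by rewrite A3.
    case: (boolP ((h x).1 == (h y).1)) => [/eqP|] exy; first by exists x, y.
    case: (boolP ((h y).1 == (h z).1)) => [/eqP|] eyz; first by exists y, z.
    exists z, x; split=> //.
    by move: exy eyz; case: (h x).1 (h y).1 (h z).1 => [] [] [].
  have [|B [Bs iB jB]] := cov (h i).2 (h j).2.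
    apply: contra ij => /eqP e; apply/eqP/h_inj.
    by rewrite [h i]surjective_pairing [h j]surjective_pairing hij e.
  have qs : ((h i).1, B) \in setX [set: bool] s by rewrite !inE.
  exists (ext (pull ((h i).1, B))); first exact: imset_f.
  have /subsetP sub := extP _ (pull3 ((h i).1, B) Bs).
  by apply/card_gt1P; exists i, j; rewrite !inE iA jA !sub ?inE ?eqxx ?hij ?eqxx.
move=> /domination_number_le /leq_trans; apply.
by apply: leq_trans (leq_imset_card _ _) _; rewrite cardsX cardsT card_bool.
Qed.

(** With [n = 2 * p], the order [p] is 1 or 3 modulo 6, and two copies of a system of order [p] use
    at most p(p-1)/3 = n(n-2)/12 blocks. *)
Lemma johnson3_le_steiner n m : n = 2 %[mod 12] \/ n = 6 %[mod 12] ->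
  2 < m <= n -> 12 * domination_number (johnson3 m) <= n * n.-2.
Proof.
move=> nmod /andP[m2 mn].
have [P [s [cP cov cs]]] : exists (P : finType) (s : {set {set P}}),
    [/\ n = 2 * #|P|, triple_cover s & 6 * #|s| <= #|P| * #|P|.-1].
  case: nmod => nmod.
    have [P [s [cP cov cs]]] := skolem (n %/ 12).
    by exists P, s; split=> //; rewrite cP; lia.
  have [P [s [cP cov cs]]] := bose (n %/ 12).
  by exists P, s; split=> //; rewrite cP; lia.
have := johnson3_le_cover (n := m) (s := s); rewrite -cP m2 mn => /(_ isT cov).
by move: (#|P|) cP cs => p ->; case: p => [|p]; nia.
Qed.

Lemma johnson3_le n : 2 < n ->
  12 * domination_number (johnson3 n) <= (n + 8) * (n + 6).
Proof.
move=> n2.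
have [k [nk kmod]] : exists k, n <= k <= n + 8 /\ (k = 2 %[mod 12] \/ k = 6 %[mod 12]).
  (* The least admissible order from [n] on; consecutive ones differ by 4 or 8. *)
  exists (if n %% 12 <= 2 then 12 * (n %/ 12) + 2
          else if n %% 12 <= 6 then 12 * (n %/ 12) + 6 else 12 * (n %/ 12) + 14).
  by case: ifP => [|_]; [|case: ifP]; lia.
have := johnson3_le_steiner (m := n) kmod.
rewrite n2 => /(_ _)/leq_trans; case/andP: nk => nk k8; apply=> //.
by apply: leq_mul; lia.
Qed.

Lemma johnson3_ge n :
  n * n.-2 <= 12 * domination_number (johnson3 n).
Proof.
have [D dom ->] := domination_number_attained (johnson3 n).
exact: dominating_lower.
Qed.

Lemma johnson3_ge_odd n : 1 < n -> odd n ->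
  n * n.-2 + 3 <= 12 * domination_number (johnson3 n).
Proof.
move=> n1 on; have [D dom ->] := domination_number_attained (johnson3 n).
exact: dominating_lower_odd.
Qed.

(* Asymptotics over the reals *)
From mathcomp Require Import all_classical all_reals topology normedtype.
From mathcomp Require Import sequences ring lra.
Import Order.TTheory GRing.Theory Num.Theory numFieldNormedType.Exports.
Local Open Scope classical_set_scope.
Local Open Scope ring_scope.

Lemma cvg_scaled_harmonic (R : realType) (c : R) :
  c * harmonic n @[n --> \oo] --> (0 : R).
Proof. by rewrite -[0](mulr0 c); apply: cvgMr; exact: cvg_harmonic. Qed.

(** One estimate serves both parities: [e] is 0 for even [n] and 3 for odd [n]. *)
Lemma johnson3_real_bounds (R : realType) n e : (4 <= n)%N ->
  (n * n.-2 + e <= 12 * domination_number (johnson3 n))%N ->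
  n%:R ^+ 2 / 12 - n%:R / 6 + e%:R / 12 <=
    ((domination_number (johnson3 n))%:R : R)
    <= (1 + 112 * harmonic n) * (n%:R ^+ 2 / 12 - n%:R / 6 + e%:R / 12).
Proof.
move=> n4; have := @johnson3_le n (ltnW n4).
move: (domination_number _) => g.
rewrite -(ler_nat R) !natrM !natrD -(ler_nat R) natrD !natrM => ub.
have -> : n.-2%:R = n%:R - 2 :> R by rewrite -subn2 natrB // (ltnW (ltnW n4)).
move=> lb; have x4 : 4 <= n%:R :> R by rewrite (ler_nat R 4).
have e0 : 0 <= e%:R :> R by [].
have h0 : 0 < harmonic n :> R by rewrite invr_gt0 ltr0n.
have hM : harmonic n * (n%:R + 1) = 1 :> R.
  by rewrite /harmonic /= natr1 mulVf // pnatr_eq0.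
move: (n%:R : R) (g%:R : R) (e%:R : R) (harmonic n : R) ub lb x4 e0 h0 hM.
move=> x y z h ub lb x4 z0 h0 hM; apply/andP; split; first by nra.
(* The left side is the excess of (x+8)(x+6) over x(x-2). As [h] is 1/(x+1), the factor 112 suffices
   from x = 4 on. *)
have key : 16 * x + 48 <= 112 * h * (x ^+ 2 - 2 * x).
  rewrite -[leLHS]mulr1 -[X in _ * X]hM -subr_ge0.
  rewrite (_ : _ - _ = h * (96 * x * (x - 3) - 48)); last by ring.
  by apply: mulr_ge0; [exact: ltW|nra].
have : 0 <= h * z by apply: mulr_ge0 => //; exact: ltW.
nra.
Qed.

Theorem theorem4p2 (R : realType) :
  [/\ exists2 o : nat -> R, o n @[n --> \oo] --> (0 : R) &
        forall n : nat, (4 <= n)%N -> ~~ odd n ->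
          (n%:R ^+ 2 / 12 - n%:R / 6 : R)
            <= (domination_number (token_graph 3 (complete_graph n)))%:R
            <= (1 + o n) * (n%:R ^+ 2 / 12 - n%:R / 6),
      exists2 o : nat -> R, o n @[n --> \oo] --> (0 : R) &
        forall n : nat, (4 <= n)%N -> odd n ->
          (n%:R ^+ 2 / 12 - n%:R / 6 + 1 / 4 : R)
            <= (domination_number (token_graph 3 (complete_graph n)))%:R
            <= (1 + o n) * (n%:R ^+ 2 / 12 - n%:R / 6 + 1 / 4)
    & forall n : nat, (4 <= n)%N ->
        n = 2 %[mod 12] \/ n = 6 %[mod 12] ->
        (domination_number (token_graph 3 (complete_graph n)))%:R
          = n%:R ^+ 2 / 12 - n%:R / 6 :> R].
Proof.
split.
- exists (fun n => 112 * harmonic n); first exact: cvg_scaled_harmonic.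
  move=> n n4 _; have := johnson3_real_bounds R n4 (e := 0).
  by rewrite addn0 mul0r addr0; apply; exact: johnson3_ge.
- exists (fun n => 112 * harmonic n); first exact: cvg_scaled_harmonic.
  move=> n n4 on; have := johnson3_real_bounds R n4 (johnson3_ge_odd (ltnW (ltnW n4)) on).
  by rewrite (_ : 3%:R / 12 = 1 / 4) //; field.
- move=> n n4 nmod.
  have : (12 * domination_number (johnson3 n) = n * n.-2)%N.
    apply/eqP; rewrite eqn_leq johnson3_ge andbT.
    by apply: johnson3_le_steiner => //; rewrite leqnn andbT ltnW.
  move/(congr1 (fun k => k%:R : R)); rewrite !natrM.
  have -> : n.-2%:R = n%:R - 2 :> R by rewrite -subn2 natrB // (ltnW (ltnW n4)).
  by move=> e; lra.
Qed.
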